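(* Let $\Gamma=\langle\mathcal{A},\mathcal{R}\rangle$ be an AFRA which is an AF, i.e. $\mathcal{R}\subseteq\mathcal{A}\times\mathcal{A}$, and let $\mathcal{S}\subseteq\mathcal{A}\cup\mathcal{R}$. Then $\mathcal{S}$ is a stable extension of $\Gamma$ if and only if $\mathcal{S}=\mathcal{U}^{\rightarrow AFRA}$ for some $\mathcal{U}\subseteq\mathcal{A}$ which is a D-stable extension of $\Gamma$.
   Context: An AFRA (Argumentation Framework with Recursive Attacks) is a pair $\langle\mathcal{A},\mathcal{R}\rangle$ where $\mathcal{A}$ is a set (of arguments) and $\mathcal{R}$ is a set of attacks, each attack being a pair $\alpha=(A,X)$ with $A\in\mathcal{A}$ and ($X\in\mathcal{R}$ or $X\in\mathcal{A}$); $A=src(\alpha)$ is its source and $X=trg(\alpha)$ its target. Arguments and attacks are distinct objects ($\mathcal{A}\cap\mathcal{R}=\emptyset$). Defeat: for $\alpha\in\mathcal{R}$, $V\in\mathcal{A}\cup\mathcal{R}$, $\alpha$ directly defeats $V$ iff $V=trg(\alpha)$; $\alpha$ indirectly defeats $\beta\in\mathcal{R}$ iff $\alpha$ directly defeats $src(\beta)$; $\alpha\rightarrow_R V$ ($\alpha$ defeats $V$) iff $\alpha$ directly or indirectly defeats $V$. Only attacks can defeat. A set $\mathcal{S}\subseteq\mathcal{A}\cup\mathcal{R}$ is conflict-free iff there are no $V,W\in\mathcal{S}$ with $V\rightarrow_R W$. $\mathcal{S}$ is a stable extension iff it is conflict-free and for every $V\in(\mathcal{A}\cup\mathcal{R})\setminus\mathcal{S}$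 there is $\alpha\in\mathcal{S}$ with $\alpha\rightarrow_R V$. Dung notions (for $\Gamma$ viewed as a Dung argumentation framework with set of arguments $\mathcal{A}$ and attack relation $\mathcal{R}\subseteq\mathcal{A}\times\mathcal{A}$): $\mathcal{U}\subseteq\mathcal{A}$ is D-conflict-free if there are no $A,B\in\mathcal{U}$ with $(A,B)\in\mathcal{R}$; $\mathcal{U}$ is a D-stable extension if it is D-conflict-free and for every $A\in\mathcal{A}\setminus\mathcal{U}$ there is $B\in\mathcal{U}$ with $(B,A)\in\mathcal{R}$. For $\mathcal{U}\subseteq\mathcal{A}$, $\mathcal{U}^{\rightarrow AFRA}:=\mathcal{U}\cup\{\alpha\in\mathcal{R}\mid src(\alpha)\in\mathcal{U}\}$. *)

(* Defs.v *)
From mathcomp Require Import all_boot.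
From mathcomp Require Import boolp classical_sets.

Set Implicit Arguments.
Unset Strict Implicit.
Unset Printing Implicit Defensive.

Local Open Scope classical_set_scope.

(* An attack is a pair (A, X) where X is an argument or, recursively, an
   attack. The arguments are drawn from an arbitrary universe T, and elements
   of the disjoint sum T + attack T are either arguments (inl) or attacks
   (inr), so that no argument is an attack. *)
Inductive attack (T : Type) : Type :=
  Attack of T & (T + attack T)%type.

Definition elem (T : Type) : Type := (T + attack T)%type.

Definition src (T : Type) (alpha : attack T) : T :=
  let: Attack A _ := alpha in A.

Definition trg (T : Type) (alpha : attack T) : elem T :=
  let: Attack _ X := alpha in X.

Record AFRA (T : Type) := MkAFRA {
  args : set T;
  atts : set (attack T);
  src_args : forall alpha, atts alpha -> args (src alpha);
  trg_elems : forall alpha, atts alpha ->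
    ([set inl A | A in args] `|` [set inr beta | beta in atts]) (trg alpha)
}.

Definition elems (T : Type) (G : AFRA T) : set (elem T) :=
  [set inl A | A in args G] `|` [set inr beta | beta in atts G].

Definition directly_defeats (T : Type) (G : AFRA T)
    (alpha : attack T) (V : elem T) : Prop :=
  [/\ atts G alpha, elems G V & V = trg alpha].

Definition indirectly_defeats (T : Type) (G : AFRA T)
    (alpha beta : attack T) : Prop :=
  [/\ atts G alpha, atts G beta & directly_defeats G alpha (inl (src beta))].

Definition defeats (T : Type) (G : AFRA T)
    (alpha : attack T) (V : elem T) : Prop :=
  directly_defeats G alpha V \/
  exists2 beta, V = inr beta & indirectly_defeats G alpha beta.

(* Only attacks can defeat, so V ->_R W is meaningful only for V an attack. *)
Definition conflict_free (T : Type) (G : AFRA T) (S : set (elem T)) : Prop :=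
  ~ exists alpha W, [/\ S (inr alpha), S W & defeats G alpha W].

Definition stable_extension (T : Type) (G : AFRA T) (S : set (elem T)) : Prop :=
  conflict_free G S /\
  forall V, (elems G `\` S) V -> exists2 alpha, S (inr alpha) & defeats G alpha V.

Record AF (T : Type) := MkAF {
  D_args : set T;
  D_atts : set (T * T);
  D_atts_sub : D_atts `<=` D_args `*` D_args
}.

Definition D_conflict_free (T : Type) (F : AF T) (U : set T) : Prop :=
  ~ exists A B, [/\ U A, U B & D_atts F (A, B)].

Definition D_stable_extension (T : Type) (F : AF T) (U : set T) : Prop :=
  D_conflict_free F U /\
  forall A, (D_args F `\` U) A -> exists2 B, U B & D_atts F (B, A).

(* The embedding of ordinary pairs of arguments into attacks. *)
Definition attack_of_pair (T : Type) (p : T * T) : attack T :=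
  Attack p.1 (inl p.2).

Definition is_AF (T : Type) (G : AFRA T) : Prop :=
  atts G `<=` [set attack_of_pair p | p in args G `*` args G].

Lemma AF_of_subproof (T : Type) (G : AFRA T) :
  attack_of_pair (T:=T) @^-1` atts G `<=` args G `*` args G.
Proof.
move=> [A B] /= GAB; split; first exact: (src_args GAB).
by case: (trg_elems GAB) => [[C GC [<-]]|[]].
Qed.

(* When is_AF G holds, this is G itself viewed as a Dung framework; otherwise
   the attacks on attacks are discarded. *)
Definition AF_of (T : Type) (G : AFRA T) : AF T :=
  MkAF (@AF_of_subproof T G).

Definition to_AFRA (T : Type) (G : AFRA T) (U : set T) : set (elem T) :=
  [set inl A | A in U] `|`
  [set inr alpha | alpha in [set alpha | atts G alpha /\ U (src alpha)]].

(* Main.v *)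
Require Import Defs.
From mathcomp Require Import all_boot.
From mathcomp Require Import boolp classical_sets.

Local Open Scope classical_set_scope.

(* In an AF no attack is the target of another one, so an attack is defeated
   exactly when its source is. As a stable extension consists of the elements
   it does not defeat, it contains an attack iff it contains its source, and is
   thus determined by its arguments. *)

Lemma elems_inl (T : Type) (G : AFRA T) (A : T) :
  elems G (inl A) <-> args G A.
Proof.
split; last by move=> GA; left; exists A.
by case=> [[B GB [<-]]|[]].
Qed.

Lemma elems_inr (T : Type) (G : AFRA T) (alpha : attack T) :
  elems G (inr alpha) <-> atts G alpha.
Proof.
split; last by move=> Ga; right; exists alpha.
by case=> [[]|[b Gb [<-]]].
Qed.

Lemma to_AFRA_inl (T : Type) (G : AFRA T) (U : set T) (A : T) :
  to_AFRA G U (inl A) <-> U A.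
Proof.
split; last by move=> UA; left; exists A.
by case=> [[B UB [<-]]|[]].
Qed.

Lemma to_AFRA_inr (T : Type) (G : AFRA T) (U : set T) (alpha : attack T) :
  to_AFRA G U (inr alpha) <-> atts G alpha /\ U (src alpha).
Proof.
split; last by move=> Ga; right; exists alpha.
by case=> [[]|[b Gb [<-]]].
Qed.

(** Indirect defeat only reaches attacks, so direct defeat alone is left. The equation puts [alpha]
    in the form of a Dung attack, [D_atts (AF_of G)] being the preimage of [atts G] under
    [attack_of_pair]. *)
Lemma defeats_inl (T : Type) (G : AFRA T) (alpha : attack T) (A : T) :
  defeats G alpha (inl A) <->
  atts G alpha /\ alpha = attack_of_pair (src alpha, A).
Proof.
split=> [[[Ga _]|[]//]|[Ga eqa]].
  by case: alpha Ga => B X /[swap] /= <-.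
(* Direct defeat also requires [A] to be an argument of [G]; this holds because [A] is the target of
   an attack of [G]. *)
by left; split=> //; [have := trg_elems Ga; rewrite eqa|rewrite eqa].
Qed.

Lemma AF_defeats_inr (T : Type) (G : AFRA T) (alpha beta : attack T) :
  is_AF G ->
  defeats G alpha (inr beta) <->
  atts G beta /\ defeats G alpha (inl (src beta)).
Proof.
move=> hAF; split=> [[[Ga _ eq_trg]|[_ [<-] [_ Gb dir]]]|[Gb []]].
- by case: (hAF _ Ga) eq_trg => p _ <-.
- by split=> //; left.
- by move=> dir; right; exists beta => //; split=> //; case: dir.
- by case.
Qed.

(** If just one of the two were missing from [S], some [beta] in [S] would defeat it. Both have the
    same defeaters, so [beta] would also defeat the one in [S], against conflict-freeness. *)
Lemma stable_extension_src (T : Type) (G : AFRA T) (S : set (elem T))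
    (alpha : attack T) :
  is_AF G -> stable_extension G S -> atts G alpha ->
  S (inr alpha) <-> S (inl (src alpha)).
Proof.
move=> hAF [cfS stS] Ga; split=> Sa; apply: contrapT => nSa.
  have [|beta Sb def] := stS (inl (src alpha)).
    by split=> //; apply/elems_inl/src_args.
  by apply: cfS; exists beta, (inr alpha); split=> //; apply/AF_defeats_inr.
have [|beta Sb /(AF_defeats_inr _ _ _ _ hAF)[_ def]] := stS (inr alpha).
  by split=> //; apply/elems_inr.
by apply: cfS; exists beta, (inl (src alpha)).
Qed.

Lemma stable_extension_to_AFRA (T : Type) (G : AFRA T) (S : set (elem T)) :
  is_AF G -> S `<=` elems G -> stable_extension G S ->
  S = to_AFRA G [set A | S (inl A)].
Proof.
move=> hAF hS stS; apply/seteqP; split=> [[A|alpha] SV|[A|alpha]].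
- exact/to_AFRA_inl.
- have Ga : atts G alpha by apply/elems_inr/hS.
  by apply/to_AFRA_inr; split=> //;
    apply/(stable_extension_src _ _ _ _ hAF stS Ga).
- by move/to_AFRA_inl.
- by move/to_AFRA_inr=> [Ga Sa];
    apply/(stable_extension_src _ _ _ _ hAF stS Ga).
Qed.

Lemma stable_extension_D_stable (T : Type) (G : AFRA T) (S : set (elem T)) :
  is_AF G -> S `<=` elems G -> stable_extension G S ->
  D_stable_extension (AF_of G) [set A | S (inl A)].
Proof.
move=> hAF hS stS; have [cfS defS] := stS.
split=> [[A [B [SA SB GAB]]]|A [GA nSA]].
  (* The attack from [A] to [B] lies in [S] because its source does, so a Dung conflict becomes a
     defeat inside [S]. *)
  apply: cfS; exists (attack_of_pair (A, B)), (inl B); split=> //.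
    exact/(stable_extension_src _ _ _ _ hAF stS GAB).
  exact/defeats_inl.
have [|alpha Sa /defeats_inl[Ga eqa]] := defS (inl A).
  by split=> //; apply/elems_inl.
(* A defeater in [S] brings its source into [S], and that source is the Dung attacker of [A]. *)
exists (src alpha); first exact/(stable_extension_src _ _ _ _ hAF stS Ga).
by rewrite /= -eqa.
Qed.

Lemma D_stable_to_AFRA_stable (T : Type) (G : AFRA T) (U : set T) :
  is_AF G -> D_stable_extension (AF_of G) U ->
  stable_extension G (to_AFRA G U).
Proof.
move=> hAF [cfU defU].
(* The next two facts settle both halves of stability for arguments; an attack is then treated
   through its source. *)
have cf_arg alpha A : U (src alpha) -> U A -> ~ defeats G alpha (inl A).
  move=> Ua UA /defeats_inl[Ga eqa].
  by apply: cfU; exists (src alpha), A; split=> //=; rewrite -eqa.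
have def_arg A : args G A -> ~ U A ->
    exists2 alpha, to_AFRA G U (inr alpha) & defeats G alpha (inl A).
  move=> GA nUA; have [//|B UB GBA] := defU A.
  (* The Dung attack itself is the defeater: it is in [to_AFRA G U] since its source [B] is in
     [U]. *)
  by exists (attack_of_pair (B, A)); [apply/to_AFRA_inr|apply/defeats_inl].
split=> [[alpha [[A|beta] [/to_AFRA_inr[_ Ua]]]]|[A|beta] [GV nUV]].
- by move/to_AFRA_inl; apply: cf_arg.
- move=> /to_AFRA_inr[_ Ub] /(AF_defeats_inr _ _ _ _ hAF)[_].
  exact: cf_arg.
- by apply: def_arg; [apply/elems_inl|move/to_AFRA_inl/nUV].
- have Gb : atts G beta by apply/elems_inr.
  have [||alpha Ua def] := def_arg (src beta).
  + exact: src_args.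
  + by move=> Ub; apply/nUV/to_AFRA_inr.
  + by exists alpha => //; apply/AF_defeats_inr.
Qed.

Theorem proposition9 (T : Type) (G : AFRA T) (S : set (elem T))
    (hAF : is_AF G) (hS : S `<=` elems G) :
  stable_extension G S <->
  exists U : set T,
    [/\ U `<=` args G, D_stable_extension (AF_of G) U & S = to_AFRA G U].
Proof.
split=> [stS|[U [_ stU ->]]]; last exact: D_stable_to_AFRA_stable.
exists [set A | S (inl A)]; split.
- by move=> A SA; apply/elems_inl/hS.
- exact: stable_extension_D_stable.
- exact: stable_extension_to_AFRA.
Qed.
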